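(* Let $\alpha\in[0,1)$ and let $G$ be a connected graph of order $n\ge 2$ with clique number $\omega\ge 2$. Then $\mu_{\alpha}(G)\le\mu_{\alpha}(Ki_{n,\omega})$, with equality if and only if $G\cong Ki_{n,\omega}$.
   Context: All graphs are finite, simple and undirected. The clique number of $G$ is the maximum number of vertices in a set inducing a complete subgraph. For $2\le\omega\le n$, $Ki_{n,\omega}$ is the graph obtained from a complete graph $K_{\omega}$ and a (disjoint) path $P_{n-\omega}$ on $n-\omega$ vertices by adding an edge between a vertex of $K_\omega$ and a terminal vertex of $P_{n-\omega}$ if $\omega<n$, and $Ki_{n,n}=K_n$. For a connected graph $G$ with distance function $d_G$, the transmission of a vertex $u$ is $T_G(u)=\sum_{v\in V(G)}d_G(u,v)$, $T(G)$ is the diagonal matrix of transmissions and $D(G)=(d_G(u,v))_{u,v\in V(G)}$ the distance matrix. For $\alpha\in[0,1)$, $D_{\alpha}(G)=\alpha T(G)+(1-\alpha)D(G)$, and $\mu_{\alpha}(G)$ (the distance $\alpha$-spectral radius) is the largest eigenvalue of the symmetric matrix $D_{\alpha}(G)$. *)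

(* Defs.v *)
From HB Require Import structures.
From mathcomp Require Import all_boot all_order all_algebra.
From mathcomp Require Import boolp classical_sets reals.

Set Implicit Arguments.
Unset Strict Implicit.
Unset Printing Implicit Defensive.

Import Order.TTheory GRing.Theory Num.Theory.
Local Open Scope ring_scope.

Record sgraph := SGraph {
  vertex :> finType;
  edge : rel vertex;
  edge_sym : symmetric edge;
  edge_irrefl : irreflexive edge }.

Definition sgraph_connected (G : sgraph) : Prop :=
  forall u v : G, connect (@edge G) u v.

Definition sgraph_iso (G H : sgraph) : Prop :=
  exists f : G -> H,
    bijective f /\ forall u v : G, edge (f u) (f v) = edge u v.

Definition clique (G : sgraph) (A : {set G}) : bool :=
  [forall u in A, forall v in A, (u != v) ==> edge u v].

Definition clique_number (G : sgraph) : nat :=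
  (\max_(A : {set G} | clique A) #|A|)%N.

Definition has_path_of_length (G : sgraph) (u v : G) (k : nat) : bool :=
  [exists p : k.-tuple G,
    [&& path (@edge G) u p, uniq (u :: p) & last u p == v]].

(* The least length of a path from u to v. A path has at most #|G| - 1 edges,
   so the search range is sufficient; the value is the junk #|G| when v is not
   reachable from u. *)
Definition dist (G : sgraph) (u v : G) : nat :=
  find (has_path_of_length u v) (iota 0 #|G|).

Definition transmission (G : sgraph) (u : G) : nat :=
  (\sum_(v : G) dist u v)%N.

Definition transmission_mx (R : realType) (G : sgraph) : 'M[R]_#|G| :=
  diag_mx (\row_i (transmission (enum_val i : G))%:R).

Definition dist_mx (R : realType) (G : sgraph) : 'M[R]_#|G| :=
  \matrix_(i, j) (dist (enum_val i : G) (enum_val j : G))%:R.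

Definition dist_alpha_mx (R : realType) (alpha : R) (G : sgraph) :
    'M[R]_#|G| :=
  alpha *: transmission_mx R G + (1 - alpha) *: dist_mx R G.

(* The set of real eigenvalues is finite, and nonempty for a symmetric matrix
   of positive size, so that its supremum is then its maximum. *)
Definition largest_eigenvalue (R : realType) (m : nat) (A : 'M[R]_m) : R :=
  sup [set a : R | eigenvalue A a]%classic.

Definition dist_alpha_radius (R : realType) (alpha : R) (G : sgraph) : R :=
  largest_eigenvalue (dist_alpha_mx alpha G).

(* K_omega is carried by 0, ..., omega - 1 and the path by
   omega, ..., n - 1 in this order; the edge joining them is
   {omega - 1, omega}. *)
Definition kite_edge (n omega : nat) : rel 'I_n := fun i j =>
  if (i < omega)%N && (j < omega)%N then i != j
  else (i.+1 == j :> nat) || (j.+1 == i :> nat).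

Lemma kite_edge_sym (n omega : nat) : symmetric (@kite_edge n omega).
Proof. by move=> i j; rewrite /kite_edge andbC eq_sym orbC. Qed.

Lemma kite_edge_irrefl (n omega : nat) : irreflexive (@kite_edge n omega).
Proof.
by move=> i; rewrite /kite_edge eqxx orbb (gtn_eqF (ltnSn i)); case: ifP.
Qed.

Definition Ki (n omega : nat) : sgraph :=
  SGraph (@kite_edge_sym n omega) (@kite_edge_irrefl n omega).

(* Main.v *)
(* Call G dominated if two connected graphs H1, H2 on its vertices, both with
   a clique of size omega, satisfy 2 d_G <= d_H1 + d_H2 pointwise, strictly
   somewhere. The quadratic form of D_alpha is increasing in the distances on
   positive vectors, so the Perron vector of G shows that H1 or H2 has a larger
   radius than G. Hence a graph of maximal radius is not dominated, and it is
   enough to show that every graph other than the kite is dominated.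
   Deleting an edge increases distances, so only a clique K with trees hanging
   on its vertices remains. If a vertex has two children outside K, move one of
   the two branches one step up or one step down the tree; if two vertices u, v
   of K have children u', v' outside K, move the rest of K from the edge u v to
   u u' or to v v'. By convexity of the distance along a path, each pair of
   moves dominates G. *)
Require Import Defs.
From mathcomp Require Import all_boot all_order all_algebra.
From mathcomp Require Import zify.

Set Implicit Arguments.
Unset Strict Implicit.
Unset Printing Implicit Defensive.

Import Order.TTheory.
Local Open Scope nat_scope.

(** * Geodesic distance in a connected graph, and distance to a set *)

Section Distance.
Variable G : sgraph.
Implicit Types (u v x y z : G) (p : seq G) (A : {set G}).

Lemma has_path_of_lengthI u p : path (@edge G) u p -> uniq (u :: p) ->
  has_path_of_length u (last u p) (size p).
Proof.
by move=> Gp Up; apply/existsP; exists (in_tuple p); apply/and3P; split.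
Qed.

(** [p] may repeat vertices; shortening it yields a simple path with fewer than [#|G|] edges, hence
    within the range searched by [dist]. *)
Lemma dist_le_path u p : path (@edge G) u p -> dist u (last u p) <= size p.
Proof.
case/shortenP=> q Gq Uq sub_qp.
have le_qp : size q <= size p.
  by apply: uniq_leq_size => //; case/andP: Uq.
apply: leq_trans le_qp; rewrite leqNgt; apply/negP=> lt_q.
have ltG : size q < #|G|.
  by have := max_card (mem (u :: q)); rewrite (card_uniqP Uq).
have := before_find 0 lt_q; rewrite nth_iota // add0n.
by rewrite has_path_of_lengthI.
Qed.

Lemma dist_self u : dist u u = 0.
Proof. by have := @dist_le_path u [::] isT; rewrite leqn0 => /eqP. Qed.

Hypothesis G_conn : sgraph_connected G.

Lemma dist_path u v :
  exists p, [/\ path (@edge G) u p, last u p = v & size p = dist u v].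
Proof.
have /connectP[p Gp ->] := G_conn u v.
case/shortenP: Gp => q Gq Uq _.
have ltG : size q < #|G|.
  by have := max_card (mem (u :: q)); rewrite (card_uniqP Uq).
have has_p : has (has_path_of_length u (last u q)) (iota 0 #|G|).
  apply/hasP; exists (size q); first by rewrite mem_iota.
  exact: has_path_of_lengthI.
have := nth_find 0 has_p; rewrite -/(dist u (last u q)) nth_iota; last first.
  by rewrite -[X in _ < X](size_iota 0) -has_find.
rewrite add0n => /existsP[t /and3P[Gt _ /eqP tq]].
by exists t; rewrite size_tuple.
Qed.

(** The tool for lower bounds on distances: [f] gains at most one on each edge of a geodesic. *)
Lemma lipschitz_le_dist (f : G -> nat) u v :
  (forall x y, edge x y -> f y <= (f x).+1) -> f v <= f u + dist u v.
Proof.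
move=> f_lip; have [p [Gp lp <-]] := dist_path u v; rewrite -{}lp; move: Gp.
elim: p u => [|x p IHp] u /= => [_|/andP[/f_lip ux /IHp]].
  by rewrite addn0.
by move: ux; clear; lia.
Qed.

Lemma dist_eq0 u v : (dist u v == 0) = (u == v).
Proof.
apply/eqP/eqP=> [d0|->]; last exact: dist_self.
by have [p [_ lp]] := dist_path u v; rewrite d0 -lp => /size0nil ->.
Qed.

Lemma dist_triangle v u w : dist u w <= dist u v + dist v w.
Proof.
have [p [Gp lp <-]] := dist_path u v; have [q [Gq lq <-]] := dist_path v w.
rewrite -size_cat -lq -lp -last_cat; apply: dist_le_path.
by rewrite cat_path Gp lp.
Qed.

Lemma dist_edge u v : edge u v -> dist u v = 1.
Proof.
move=> uv; apply/eqP; rewrite eqn_leq lt0n dist_eq0.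
rewrite (@dist_le_path u [:: v]) /= ?uv //.
by apply/eqP=> e; rewrite e edge_irrefl in uv.
Qed.

Lemma dist_sym u v : dist u v = dist v u.
Proof.
suff le (a b : G) : dist a b <= dist b a.
  by apply/eqP; rewrite eqn_leq !le.
(* With [f x = dist x b], which vanishes at [b], the Lipschitz bound becomes
   [dist a b <= 0 + dist b a]. *)
rewrite -[dist b a]add0n -(dist_self b).
apply: (lipschitz_le_dist (f := fun x => dist x b)) => x y xy.
by rewrite -[_.+1]add1n -(@dist_edge y x) ?dist_triangle // edge_sym.
Qed.

Lemma dist_edge_le z x y : edge x y -> dist z y <= (dist z x).+1.
Proof. by move/dist_edge=> e; rewrite -addn1 -e dist_triangle. Qed.

Lemma dist_closer u v :
  u != v -> exists2 z, edge u z & dist u v = (dist z v).+1.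
Proof.
move=> uv; have [[|z p] /= [Gp lp sp]] := dist_path u v.
  by rewrite lp eqxx in uv.
case/andP: Gp => uz Gp; exists z => //; apply/eqP; rewrite eqn_leq.
rewrite -{1}[(_).+1]add1n -(dist_edge uz) dist_triangle /= -sp ltnS -lp.
exact: dist_le_path.
Qed.

(** The default [#|G|] is the value for empty [A]; it never disturbs the minimum over a nonempty
    set, since [dist] does not exceed [#|G|]. *)
Definition set_dist A x : nat := \big[Order.min/#|G|]_(a in A) dist a x.

Lemma set_dist_le A a x : a \in A -> set_dist A x <= dist a x.
Proof. by move=> aA; rewrite -leEnat; apply: bigmin_le_cond. Qed.

Lemma set_dist_attained A x :
  A != set0 -> exists2 a, a \in A & set_dist A x = dist a x.
Proof.
case/set0Pn=> a0 a0A; case: (arg_minnP (fun a => dist a x) a0A) => a aA min_a.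
exists a => //; apply/eqP; rewrite eqn_leq set_dist_le //= -leEnat.
apply: le_bigmin => [|b bA]; last exact: min_a.
by rewrite leEnat /dist -[X in _ <= X](size_iota 0) find_size.
Qed.

Lemma set_dist_edge_le A x y :
  A != set0 -> edge x y -> set_dist A y <= (set_dist A x).+1.
Proof.
move=> A0 xy; have [a aA ->] := set_dist_attained x A0.
exact: leq_trans (set_dist_le _ aA) (dist_edge_le _ xy).
Qed.

End Distance.

(** * Graphs on a fixed vertex set, given by relations *)

Section GraphOn.
Variables (V : finType) (e : rel V).

(** Symmetrizing and removing loops turns any relation into a graph, so that graphs on [V] can be
    quantified over as relations. *)
Definition graph_on_edge : rel V := fun x y => (x != y) && (e x y || e y x).

Lemma graph_on_edge_sym : symmetric graph_on_edge.
Proof. by move=> x y; rewrite /graph_on_edge eq_sym orbC. Qed.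

Lemma graph_on_edge_irrefl : irreflexive graph_on_edge.
Proof. by move=> x; rewrite /graph_on_edge eqxx. Qed.

Definition graph_on : sgraph := SGraph graph_on_edge_sym graph_on_edge_irrefl.

Lemma graph_onE : symmetric e -> irreflexive e ->
  forall x y : graph_on, edge x y = e x y.
Proof.
move=> e_sym e_irr x y; rewrite /= /graph_on_edge (e_sym y) orbb.
by case: eqP => //= ->; rewrite e_irr.
Qed.

(** A boolean, so that a maximum can be taken over it. The clique need not be a largest one: a move
    only has to exhibit some clique of size [w]. *)
Definition connected_with_clique (w : nat) : bool :=
  [forall x : graph_on, forall y : graph_on, connect (@edge graph_on) x y] &&
  [exists K : {set graph_on}, clique K && (#|K| == w)].

Lemma connected_with_cliqueP (w : nat) :
  reflect (sgraph_connected graph_on /\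
           exists2 K : {set graph_on}, clique K & #|K| = w)
          (connected_with_clique w).
Proof.
apply: (iffP andP) => -[conn hK]; split.
- by move=> x y; move/forallP/(_ x)/forallP: conn; apply.
- by case/existsP: hK => K /andP[cK /eqP wK]; exists K.
- by apply/forallP=> x; apply/forallP=> y; apply: conn.
- by case: hK => K cK wK; apply/existsP; exists K; rewrite cK wK /=.
Qed.

End GraphOn.

Lemma cliqueP (G : sgraph) (A : {set G}) :
  reflect {in A &, forall x y, x != y -> edge x y} (clique A).
Proof.
apply: (iffP forall_inP) => [h x y xA yA xy | h x xA].
  by move/forall_inP/(_ y yA)/implyP: (h x xA); apply.
by apply/forall_inP=> y yA; apply/implyP; apply: h.
Qed.

Definition dominated (w : nat) (G : sgraph) : Prop :=
  exists e1 e2 : rel G,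
    [/\ connected_with_clique e1 w, connected_with_clique e2 w,
        forall x y : G, 2 * dist x y <=
          @dist (graph_on e1) x y + @dist (graph_on e2) x y &
        exists x y : G, 2 * dist x y <
          @dist (graph_on e1) x y + @dist (graph_on e2) x y].

(** * Detaching a vertex set [X] and attaching it elsewhere *)

Section Reattach.
Variables (G : sgraph) (G_conn : sgraph_connected G).
Variables (X A : {set G}).
Hypotheses (sub_AX : A \subset X) (A0 : A != set0) (A_clique : clique A).
Implicit Types (S T : {set G}) (x y z : G).

Lemma dist_clique_le S x y : clique S -> x \in S -> y \in S -> dist x y <= 1.
Proof.
move=> /cliqueP cS xS yS.
have [->|xy] := eqVneq x y; first by rewrite dist_self.
by rewrite dist_edge // cS.
Qed.

Lemma dist_clique_set S x y :
  clique S -> y \in S -> dist x y <= (set_dist S x).+1.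
Proof.
move=> cS yS; have S0 : S != set0 by apply/set0Pn; exists y.
have [z zS ->] := set_dist_attained x S0.
have := dist_clique_le cS zS yS; have := dist_triangle G_conn z x y.
by rewrite (dist_sym G_conn x z); clear; lia.
Qed.

(** The expected distance once [X] is joined to its complement by the edges between [A] and [S]
    only. It is shown to bound the new distance from below, which is all that domination needs. *)
Definition attach_dist S x y : nat :=
  if x \in X then
    if y \in X then dist x y else (set_dist A x + set_dist S y).+1
  else if y \in X then (set_dist A y + set_dist S x).+1 else dist x y.

(** [E] is kept general to cover both the edges of [G] and the reattached ones. Leaving the side of
    [x] and coming back gives no shortcut because [A] and [S] are cliques: the vertex of return is
    at most one step further from [x] than the clique itself. *)
Lemma attach_dist_lip S (E : rel G) x y z :
  S != set0 -> clique S -> symmetric E ->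
  (forall u v, (u \in X) = (v \in X) -> E u v -> edge u v) ->
  (forall u v, u \in X -> v \notin X -> E u v -> (u \in A) && (v \in S)) ->
  E y z -> attach_dist S x z <= (attach_dist S x y).+1.
Proof.
move=> S0 cS Esym E_in E_cross Eyz; rewrite /attach_dist.
have Ezy : E z y by rewrite Esym.
have [yX|yX] := boolP (y \in X); have [zX|zX] := boolP (z \in X).
- have yz : edge y z by apply: E_in => //; rewrite yX zX.
  case: ifP => _; first exact: dist_edge_le.
  by have := set_dist_edge_le G_conn A0 yz; clear; lia.
- case/andP: (E_cross _ _ yX zX Eyz) => yA zS.
  have := set_dist_le z zS; rewrite dist_self.
  have := set_dist_le x yA; rewrite (dist_sym G_conn y).
  have := dist_clique_set x cS zS; have := set_dist_le y yA.
  by rewrite dist_self; case: ifP => _; clear; lia.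
- case/andP: (E_cross _ _ zX yX Ezy) => zA yS.
  have := set_dist_le x yS; rewrite (dist_sym G_conn y).
  have := set_dist_le y yS; rewrite dist_self.
  have := dist_clique_set x A_clique zA.
  have := set_dist_le z zA; rewrite dist_self.
  by case: ifP => _; clear; lia.
- have yz : edge y z.
    by apply: E_in => //; rewrite (negPf yX) (negPf zX).
  case: ifP => _; last exact: dist_edge_le.
  by have := set_dist_edge_le G_conn S0 yz; clear; lia.
Qed.

Lemma attach_dist_self S x : attach_dist S x x = 0.
Proof. by rewrite /attach_dist; case: (x \in X); rewrite dist_self. Qed.

Lemma cross_dist_le S x y : S != set0 ->
  (forall u v, u \in A -> v \in S -> edge u v) ->
  dist x y <= (set_dist A x + set_dist S y).+1.
Proof.
move=> S0 AS; have [a aA ->] := set_dist_attained x A0.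
have [s sS ->] := set_dist_attained y S0.
have := dist_triangle G_conn a x y; have := dist_triangle G_conn s a y.
by rewrite (dist_edge G_conn (AS _ _ aA sS)) (dist_sym G_conn x a); clear; lia.
Qed.

(** When the edges of [G] already cross only between [A] and [S], the function [attach_dist S x] is
    Lipschitz on [G] itself, and it vanishes at [x]. *)
Lemma cross_dist_ge S x y :
  S != set0 -> clique S ->
  (forall u v, u \in X -> v \notin X -> edge u v -> (u \in A) && (v \in S)) ->
  x \in X -> y \notin X -> (set_dist A x + set_dist S y).+1 <= dist x y.
Proof.
move=> S0 cS cross xX yX.
have := lipschitz_le_dist G_conn (f := attach_dist S x) x y.
rewrite attach_dist_self /attach_dist xX (negPf yX); apply => u v uv.
have := @attach_dist_lip S (@edge G) x u v S0 cS (@edge_sym G) _ cross uv.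
by rewrite /attach_dist xX; apply.
Qed.

Definition reattach S : rel G := fun x y =>
  if (x \in X) == (y \in X) then edge x y
  else if x \in X then (x \in A) && (y \in S) else (y \in A) && (x \in S).

Lemma reattach_sym S : symmetric (reattach S).
Proof.
move=> x y; rewrite /reattach eq_sym edge_sym; case: eqP => //.
by case: (x \in X); case: (y \in X).
Qed.

Lemma reattach_irrefl S : irreflexive (reattach S).
Proof. by move=> x; rewrite /reattach eqxx edge_irrefl. Qed.

Lemma reattachE S (x y : graph_on (reattach S)) : edge x y = reattach S x y.
Proof. exact: (graph_onE (@reattach_sym S) (@reattach_irrefl S)). Qed.

Lemma reattach_dist_ge S (x y : G) :
  sgraph_connected (graph_on (reattach S)) -> S != set0 -> clique S ->
  attach_dist S x y <= @dist (graph_on (reattach S)) x y.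
Proof.
move=> H_conn S0 cS; rewrite -[X in _ <= X]add0n -(attach_dist_self S x).
apply: (lipschitz_le_dist H_conn (f := attach_dist S x)) => u v.
rewrite reattachE; apply: attach_dist_lip => // {u v}.
- exact: reattach_sym.
- by move=> u v uv; rewrite /reattach uv eqxx.
- by move=> u v uX vX; rewrite /reattach uX (negPf vX).
Qed.

Variable S : {set G}.
Hypotheses (S0 : S != set0) (S_clique : clique S).
Hypothesis cross : forall x y,
  x \in X -> y \notin X -> edge x y = (x \in A) && (y \in S).
Hypothesis S_out : [disjoint S & X].

(** Every vertex is joined to a fixed [s] in [S]. From outside [X], a geodesic of [G] to [s] never
    enters [X]: it could do so only from a vertex of [S], whose distance to [s] is at most 1. From
    inside, a geodesic to a vertex of [A] stays in [X] until it meets [A], where an edge leads to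
    [T]. *)
Lemma reattach_connected T : T != set0 -> [disjoint T & X] ->
  sgraph_connected (graph_on (reattach T)).
Proof.
move=> T0 TX; have [s sS] := set0Pn _ S0; have sX := disjointFr S_out sS.
set H := graph_on _; pose r := @edge H.
have r_sym : connect_sym r by apply: sym_connect_sym; apply: edge_sym.
have step (x y z : G) : reattach T x y -> connect r y z -> connect r x z.
  by move=> xy; apply: connect_trans; apply: connect1; rewrite /r reattachE.
have outside (x : G) : x \notin X -> connect r x s.
  have [k] := ubnP (dist x s); elim: k x => // k IHk x lt_k xX.
  have [->|xs] := eqVneq x s; first exact: connect0.
  have [y xy dxy] := dist_closer G_conn xs.
  have yX : y \notin X.
    apply/negP=> yX; move: (xy); rewrite edge_sym cross // => /andP[yA xS].
    have := dist_clique_le S_clique xS sS; rewrite dxy ltnS leqn0.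
    by rewrite dist_eq0 // => /eqP ys; rewrite ys sX in yX.
  apply: (@step _ y); last by apply: IHk => //; move: lt_k; rewrite dxy.
  by rewrite /reattach (negPf xX) (negPf yX).
have [t tT] := set0Pn _ T0; have tX := disjointFr TX tT.
have inA (x : G) : x \in A -> connect r x s.
  move=> xA; apply: (@step _ t); last by apply: outside; rewrite tX.
  by rewrite /reattach (subsetP sub_AX) // tX xA tT.
have [a aA] := set0Pn _ A0.
have inside (x : G) : x \in X -> connect r x s.
  have [k] := ubnP (dist x a); elim: k x => // k IHk x lt_k xX.
  have [xA|xA] := boolP (x \in A); first exact: inA.
  have xa : x != a by apply: contraNneq xA => ->.
  have [y xy dxy] := dist_closer G_conn xa.
  have yX : y \in X.
    by apply: contraLR xy => yX; rewrite cross // (negPf xA).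
  apply: (@step _ y); last by apply: IHk => //; move: lt_k; rewrite dxy.
  by rewrite /reattach xX yX.
have all_s (x : G) : connect r x s.
  by case: (boolP (x \in X)); [apply: inside | apply: outside].
by move=> x y; apply: connect_trans (all_s x) _; rewrite r_sym.
Qed.

(** Distances within [X] and within its complement do not drop. Across, both moves keep the term
    [set_dist A x], so only the distances to [S], [S1] and [S2] have to be compared. The strict pair
    is [y0] with any vertex of [A]. *)
Lemma reattach_dominated w S1 S2 (K1 K2 : {set G}) y0 :
  S1 != set0 -> [disjoint S1 & X] -> clique S1 ->
  S2 != set0 -> [disjoint S2 & X] -> clique S2 ->
  {in K1 &, forall x y, x != y -> reattach S1 x y} -> #|K1| = w ->
  {in K2 &, forall x y, x != y -> reattach S2 x y} -> #|K2| = w ->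
  (forall y, y \notin X -> 2 * set_dist S y <= set_dist S1 y + set_dist S2 y) ->
  y0 \notin X -> 2 * set_dist S y0 < set_dist S1 y0 + set_dist S2 y0 ->
  dominated w G.
Proof.
move=> S10 S1X cS1 S20 S2X cS2 cK1 wK1 cK2 wK2 avg y0X avg0.
have conn1 := reattach_connected S10 S1X.
have conn2 := reattach_connected S20 S2X.
have AS u v : u \in A -> v \in S -> edge u v.
  move=> uA vS; rewrite cross ?uA ?vS ?(subsetP sub_AX u uA) //.
  by rewrite (disjointFr S_out vS).
have ge1 x y := reattach_dist_ge x y conn1 S10 cS1.
have ge2 x y := reattach_dist_ge x y conn2 S20 cS2.
exists (reattach S1), (reattach S2); split.
- apply/connected_with_cliqueP; split=> //; exists K1 => //.
  by apply/cliqueP=> x y xK yK xy; rewrite reattachE cK1.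
- apply/connected_with_cliqueP; split=> //; exists K2 => //.
  by apply/cliqueP=> x y xK yK xy; rewrite reattachE cK2.
- move=> x y; have := leq_add (ge1 x y) (ge2 x y); apply: leq_trans.
  rewrite /attach_dist.
  have [xX|xX] := boolP (x \in X); have [yX|yX] := boolP (y \in X).
  + by rewrite mul2n -addnn.
  + by have := cross_dist_le x y S0 AS; have := avg y yX; clear; lia.
  + have := cross_dist_le y x S0 AS; have := avg x xX.
    by rewrite (dist_sym G_conn y); clear; lia.
  + by rewrite mul2n -addnn.
have [a aA] := set0Pn _ A0; have aX := subsetP sub_AX _ aA.
exists a, y0; apply: leq_trans (leq_add (ge1 a y0) (ge2 a y0)).
rewrite /attach_dist aX (negPf y0X).
by have := cross_dist_le a y0 S0 AS; move: avg0; clear; lia.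
Qed.

End Reattach.

(** * Adjacency as distance one, and distances to sets of one or two vertices *)

Section DistanceSmall.
Variables (G : sgraph) (G_conn : sgraph_connected G).
Implicit Types (x y : G) (A : {set G}).

Lemma dist_eq1_edge x y : dist x y = 1 -> edge x y.
Proof.
move=> d1; have xy : x != y by rewrite -dist_eq0 // d1.
have [z xz] := dist_closer G_conn xy; rewrite d1 => -[/esym/eqP].
by rewrite dist_eq0 // => /eqP <-.
Qed.

Lemma set_dist_set1 a x : set_dist [set a] x = dist a x.
Proof.
have a0 : [set a] != set0 by apply/set0Pn; exists a; rewrite inE.
by have [b /set1P -> ->] := set_dist_attained x a0.
Qed.

Lemma set_dist_set2 a b x : set_dist [set a; b] x = minn (dist a x) (dist b x).
Proof.
have ab0 : [set a; b] != set0 by apply/set0Pn; exists a; rewrite !inE eqxx.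
have leA := @set_dist_le _ [set a; b] a x (set21 a b).
have leB := @set_dist_le _ [set a; b] b x (set22 a b).
have [c /set2P[] -> e] := set_dist_attained x ab0;
  by move: leA leB; rewrite e; clear; lia.
Qed.

Lemma set_dist_eq0 A x : A != set0 -> (set_dist A x == 0) = (x \in A).
Proof.
move=> A0; apply/eqP/idP=> [d0 | xA].
  have [a aA] := set_dist_attained x A0.
  by rewrite d0 => /esym/eqP; rewrite dist_eq0 // => /eqP <-.
by apply/eqP; rewrite -leqn0 -(dist_self x) set_dist_le.
Qed.

End DistanceSmall.

(** * Cliques with trees hanging on their vertices *)

Section Parent.
Variables (G : sgraph) (K : {set G}) (p : G -> G).

Definition parent_edge : rel G := fun x y =>
  [|| [&& x \in K, y \in K & x != y], (x \notin K) && (p x == y)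
    | (y \notin K) && (p y == x)].

Lemma parent_edge_sym : symmetric parent_edge.
Proof.
by move=> x y; rewrite /parent_edge andbCA eq_sym; congr (_ || _); rewrite orbC.
Qed.

End Parent.

(* In a graph that is not dominated, only the clique K and the edges from a
   vertex to a predecessor on a geodesic towards K remain, since deleting any
   other edge increases the distances. *)
Lemma undominated_parent (G : sgraph) (K : {set G}) :
  sgraph_connected G -> clique K -> K != set0 -> ~ dominated #|K| G ->
  exists (p : G -> G) (lv : G -> nat),
    [/\ forall x, x \in K -> p x = x,
        forall x, (lv x == 0) = (x \in K),
        forall x, x \notin K -> lv x = (lv (p x)).+1 &
        forall x y, edge x y = parent_edge K p x y].
Proof.
move=> G_conn cK K0 undom; have /cliqueP Kedge := cK.
pose lv := set_dist K.
have closer x : x \notin K -> exists z, edge x z && (lv z < lv x).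
  move=> xK; have [a aK lx] := set_dist_attained x K0.
  have xa : x != a by apply: contraNneq xK => ->.
  have [z xz dz] := dist_closer G_conn xa; exists z; rewrite xz /lv lx.
  by rewrite (dist_sym G_conn a) dz ltnS (dist_sym G_conn) set_dist_le.
(* By [closer], the default [x] of [odflt] is never reached outside [K]. *)
pose p x := if x \in K then x else odflt x [pick z | edge x z && (lv z < lv x)].
have pP x : x \notin K -> edge x (p x) && (lv (p x) < lv x).
  move=> xK; rewrite /p (negPf xK); case: pickP => //= no.
  by have [z] := closer x xK; rewrite no.
(* The level drops by exactly one, since the levels of adjacent vertices differ by at most one. *)
have lv_p x : x \notin K -> lv x = (lv (p x)).+1.
  move=> /pP /andP[]; rewrite edge_sym => /(set_dist_edge_le G_conn K0).
  by rewrite -/(lv _) -/(lv _); clear; lia.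
have sub x y : parent_edge K p x y -> edge x y.
  case/or3P=> [/and3P[xK yK xy] | /andP[/pP/andP[e _] /eqP <-] //
    | /andP[/pP/andP[e _] /eqP <-]]; last by rewrite edge_sym.
  exact: Kedge.
have irr : irreflexive (parent_edge K p).
  by move=> x; apply/negP=> /sub; rewrite edge_irrefl.
have HE (x y : graph_on (parent_edge K p)) : edge x y = parent_edge K p x y.
  exact: (graph_onE (@parent_edge_sym _ K p) irr).
pose r := @edge (graph_on (parent_edge K p)).
have r_sym : connect_sym r by apply: sym_connect_sym; apply: edge_sym.
have [a aK] := set0Pn _ K0.
have to_a (x : G) : connect r x a.
  have [k] := ubnP (lv x); elim: k x => // k IHk x lt_k.
  have [xK|xK] := boolP (x \in K).
    have [->|xa] := eqVneq x a; first exact: connect0.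
    by apply: connect1; rewrite /r HE /parent_edge xK aK xa.
  apply: (@connect_trans _ _ (p x)).
    by apply: connect1; rewrite /r HE /parent_edge xK eqxx orbT.
  by apply: IHk; move: lt_k; rewrite lv_p.
have H_conn : sgraph_connected (graph_on (parent_edge K p)).
  by move=> x y; apply: connect_trans (to_a x) _; rewrite r_sym.
have le_dist (x y : G) : dist x y <= @dist (graph_on (parent_edge K p)) x y.
  rewrite -[X in _ <= X]add0n -(dist_self x).
  apply: (lipschitz_le_dist H_conn (f := dist x)) => u v.
  by rewrite HE => /sub; apply: dist_edge_le.
exists p, lv; split=> //; first by move=> x xK; rewrite /p xK.
  by move=> x; apply: set_dist_eq0.
move=> x y; apply/idP/idP; last exact: sub.
move=> xy; apply: contra_notT undom => nxy.
have good : connected_with_clique (parent_edge K p) #|K|.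
  apply/connected_with_cliqueP; split=> //; exists K => //.
  apply/cliqueP=> u v uK vK uv.
  by rewrite HE /parent_edge uK vK uv.
(* A single graph serves as both [e1] and [e2]; the strict pair is the deleted edge, whose ends are
   no longer at distance one. *)
exists (parent_edge K p), (parent_edge K p); split=> //.
  by move=> u v; rewrite mul2n -addnn leq_add.
exists x, y; rewrite addnn -mul2n ltn_pmul2l //.
rewrite ltn_neqAle le_dist andbT dist_edge //.
apply: contra nxy => /eqP/esym; move/(dist_eq1_edge H_conn).
by rewrite HE.
Qed.

(** * Branches of the trees, and the two kinds of moves *)

Section ParentGraph.
Variables (G : sgraph) (K : {set G}) (p : G -> G) (lv : G -> nat).
Hypothesis G_conn : sgraph_connected G.
Hypothesis K_ge2 : 1 < #|K|.
Hypothesis p_id : forall x, x \in K -> p x = x.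
Hypothesis lvS : forall x, x \notin K -> lv x = (lv (p x)).+1.
Hypothesis edgeE : forall x y, edge x y = parent_edge K p x y.
Implicit Types (x y z c : G).

Let edge_p x : x \notin K -> edge x (p x).
Proof. by move=> xK; rewrite edgeE /parent_edge xK eqxx orbT. Qed.

Let edge_K x y : x \in K -> y \in K -> x != y -> edge x y.
Proof. by move=> xK yK xy; rewrite edgeE /parent_edge xK yK xy. Qed.

(** Iterating [p] leads towards [K], so this is the subtree rooted at [c]. *)
Definition below c : {set G} := [set x | fconnect p x c].

Lemma below_self c : c \in below c. Proof. by rewrite inE connect0. Qed.

Lemma below_p x c : x \in below c -> x != c -> p x \in below c.
Proof.
rewrite !inE => /connectP[[|y q] /=]; first by move=> _ ->; rewrite eqxx.
by case/andP=> /eqP <- pq -> _; apply/connectP; exists q.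
Qed.

Lemma below_p_in x c : p x \in below c -> x \in below c.
Proof. by rewrite !inE; apply: connect_trans; apply: fconnect1. Qed.

Lemma below_K x c : x \in K -> x \in below c -> x = c.
Proof.
move=> xK; rewrite inE => /connectP[q].
elim: q => [_ -> //|y q IHq] /= /andP[/eqP <-]; rewrite p_id //.
Qed.

Lemma below_lv x c : x \in below c -> lv c <= lv x.
Proof.
rewrite inE => /connectP[q]; elim: q x => [x _ -> //|y q IHq] x /=.
case/andP=> /eqP <- pq lq; apply: leq_trans (IHq _ pq lq) _.
have [xK|xK] := boolP (x \in K); first by rewrite p_id.
by rewrite (lvS xK).
Qed.

Lemma p_notin_below x c : x \notin K -> p x = p c -> c \notin K ->
  p x \notin below c.
Proof.
move=> xK e cK; apply/negP=> /below_lv; rewrite e.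
by rewrite [lv c]lvS // ltnn.
Qed.

(** A branch is joined to the rest by the edge from its root to the parent alone; this is the form
    in which [reattach_dominated] asks for it. *)
Lemma below_cross c x y : c \notin K ->
  x \in below c -> y \notin below c ->
  edge x y = (x \in [set c]) && (y \in [set p c]).
Proof.
move=> cK xc yc; rewrite !in_set1; apply/idP/andP=> [|[/eqP-> /eqP->]].
  rewrite edgeE => /or3P[/and3P[xK _ _]|/andP[_ /eqP pxy]|/andP[_ /eqP pyx]].
  - by move: cK; rewrite -(below_K xK xc) xK.
  - have [e|xc'] := eqVneq x c; first by rewrite -pxy e.
    by move: yc; rewrite -pxy below_p.
  - by move: yc; rewrite below_p_in // pyx.
exact: edge_p.
Qed.

Lemma below_K_disjoint x c : c \notin K -> x \in K -> x \notin below c.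
Proof. by move=> cK xK; apply: contra cK => /(below_K xK) <-. Qed.

Lemma set1_neq0 (a : G) : [set a] != set0.
Proof. by apply/set0Pn; exists a; rewrite inE. Qed.

Lemma set1_clique (a : G) : clique [set a].
Proof. by apply/cliqueP=> x y /set1P-> /set1P->; rewrite eqxx. Qed.

(** The edge from [c] to [p c] is a bridge that every path from [x] to [y] crosses. *)
Lemma below_dist_ge c x y : c \notin K -> x \in below c -> y \notin below c ->
  dist c x + (dist (p c) y).+1 <= dist x y.
Proof.
move=> cK xc yc; rewrite addnS -(set_dist_set1 c) -(set_dist_set1 (p c)).
apply: (@cross_dist_ge _ G_conn (below c)); rewrite ?set1_neq0 ?set1_clique //.
by move=> u v uc vc; rewrite (below_cross cK).
Qed.

(* Two children c and c' of w: hang the branch of c either below c' or at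
   another neighbour a0 of w, which is one step further from c'. *)
Lemma branch_dominated c c' : c \notin K -> c' \notin K -> c != c' ->
  p c = p c' -> dominated #|K| G.
Proof.
move=> cK c'K cc' pcc'; set w := p c.
(* If [w] is in [K], another vertex of the clique is taken; otherwise the parent of [w], whose level
   is too low for either branch. *)
have [a0 [wa0 a0c a0c']] : exists a0, [/\ edge w a0, a0 \notin below c &
    a0 \notin below c'].
  have [wK|wK] := boolP (w \in K).
    have : 0 < #|K :\ w| by move: K_ge2; rewrite (cardsD1 w) wK.
    case/card_gt0P=> a; rewrite !inE => /andP[aw aK]; exists a.
    by rewrite edge_K ?below_K_disjoint // eq_sym.
  exists (p w); rewrite edge_p //; split=> //.
    by apply/negP=> /below_lv; rewrite (lvS cK) -/w (lvS wK); clear; lia.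
  apply/negP=> /below_lv; rewrite (lvS c'K) -pcc' -/w (lvS wK); clear; lia.
have wc : w \notin below c by apply: p_notin_below.
have wc' : w \notin below c' by apply: p_notin_below.
have c'c : c' \notin below c.
  by apply/negP=> /below_p; rewrite eq_sym -pcc' => /(_ cc'); apply/negP.
have out a : a \notin below c -> [disjoint [set a] & below c].
  by move=> ac; rewrite disjoints1.
have cK' S : {in K &, forall x y, x != y -> reattach (below c) [set c] S x y}.
  move=> x y xK yK xy; rewrite /reattach !(negPf (below_K_disjoint cK _)) //=.
  exact: edge_K.
(* The clique [K] avoids the branch and survives both moves. Strictness occurs at [w], at distance 0
   from its old attachment and 1 from [a0]. *)
apply: (@reattach_dominated _ G_conn (below c) [set c] _ _ _ [set w] _ _ _ _
  #|K| [set c'] [set a0] K K w);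
  rewrite ?set1_neq0 ?set1_clique ?sub1set ?below_self ?out //.
- by move=> x y; apply: below_cross.
- move=> y yc; rewrite !set_dist_set1.
  (* In the branch of [c'], compared with [w], the vertex [c'] is at most one step closer and [a0]
     at least one step further; elsewhere [c'] is at least one step further and [a0] at most one
     step closer. *)
  have [yc'|yc'] := boolP (y \in below c').
    have := below_dist_ge c'K yc' a0c'; rewrite -pcc' -/w (dist_edge _ wa0) //.
    have := dist_triangle G_conn c' w y; rewrite (dist_sym G_conn w c').
    have := dist_edge G_conn (edge_p c'K); rewrite -pcc' -/w => ->.
    by rewrite (dist_sym G_conn y a0); clear; lia.
  have := below_dist_ge c'K (below_self c') yc'; rewrite -pcc' -/w dist_self.
  have := dist_triangle G_conn a0 w y; rewrite (dist_edge G_conn wa0).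
  by clear; lia.
rewrite !set_dist_set1 dist_self.
by rewrite -(edge_sym) in wa0; rewrite (dist_edge G_conn wa0) addn1.
Qed.

(* The clique vertices u and v have children u' and v': slide the rest of the
   clique, with all that hangs on it, from the edge u v to v v' or to u u'. *)
Lemma slide_dominated u v u' v' : 2 < #|K| -> u \in K -> v \in K -> u != v ->
  u' \notin K -> v' \notin K -> p u' = u -> p v' = v -> dominated #|K| G.
Proof.
move=> K_gt2 uK vK uv u'K v'K pu' pv'.
pose A := K :\: [set u; v]; pose X := [set x | [exists a in A, fconnect p x a]].
have XP x : reflect (exists2 a, a \in A & x \in below a) (x \in X).
  rewrite inE; apply: (iffP existsP) => [[a /andP[aA xa]]|[a aA xa]];
    exists a => //.
    by rewrite inE.
  by rewrite aA; move: xa; rewrite inE.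
have AK a : a \in A -> [/\ a \in K, a != u & a != v].
  by rewrite !inE negb_or => /andP[/andP[]].
have AX : A \subset X.
  by apply/subsetP=> a aA; apply/XP; exists a => //; apply: below_self.
have XK x : x \in K -> (x \in X) = (x \in A).
  move=> xK; apply/idP/idP=> [/XP[a aA /(below_K xK) ->] //|].
  exact: (subsetP AX).
have Xp_in x : p x \in X -> x \in X.
  by move=> /XP[a aA pxa]; apply/XP; exists a => //; apply: below_p_in.
have Xp x : x \notin K -> (p x \in X) = (x \in X).
  move=> xK; apply/idP/idP=> [|/XP[a aA xa]]; first exact: Xp_in.
  apply/XP; exists a => //; apply: below_p => //.
  by apply: contraNneq xK => ->; case: (AK a aA).
have uX : u \notin X by rewrite XK // !inE eqxx.
have vX : v \notin X by rewrite XK // !inE eqxx orbT.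
have u'X : u' \notin X by rewrite -Xp // pu'.
have v'X : v' \notin X by rewrite -Xp // pv'.
(* A third vertex of [K] makes [A] nonempty. *)
have A0 : A != set0.
  rewrite -card_gt0 cardsD; have := subset_leq_card (subsetIr K [set u; v]).
  by rewrite cards2 uv; move: K_gt2; clear; lia.
have A_clique : clique A.
  by apply/cliqueP=> x y /AK[xK _ _] /AK[yK _ _]; apply: edge_K.
have uv_edge : edge u v by apply: edge_K.
have uu' : edge u u' by rewrite edge_sym -pu' edge_p.
have vv' : edge v v' by rewrite edge_sym -pv' edge_p.
have pair_clique (s t : G) : edge s t -> clique [set s; t].
  move=> st; apply/cliqueP=> x y /set2P[]-> /set2P[]->; rewrite ?eqxx //.
  by rewrite edge_sym.
have pair_out (s t : G) : s \notin X -> t \notin X -> [disjoint [set s; t] & X].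
  move=> sX tX; rewrite disjoints_subset; apply/subsetP=> x.
  by move=> /set2P[]->; rewrite inE.
have pair_neq0 (s t : G) : [set s; t] != set0.
  by apply/set0Pn; exists s; rewrite set21.
(* After the slide, [A] is complete to [t] and [t'], so the clique loses [s] and gains [t'], keeping
   its size. *)
have slid_clique (s t t' : G) : [set s; t] = [set u; v] -> s != t ->
    t' \notin K -> p t' = t ->
    {in t' |: (K :\ s) &, forall x y, x != y -> reattach X A [set t; t'] x y} /\
    #|t' |: (K :\ s)| = #|K|.
  move=> st_uv st t'K pt'.
  have sK : s \in K by have := set21 s t; rewrite st_uv => /set2P[]->.
  have tK : t \in K by have := set22 s t; rewrite st_uv => /set2P[]->.
  have AE x : (x \in A) = [&& x != s, x != t & x \in K].
    by rewrite /A -st_uv !inE negb_or andbA.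
  have tX : t \notin X by rewrite XK // AE eqxx andbF.
  have t'X : t' \notin X by rewrite -Xp // pt'.
  have tt' : edge t t' by rewrite edge_sym -pt' edge_p.
  have cl x y : x \in t' |: (K :\ s) -> y \in K :\ s -> x != y ->
      reattach X A [set t; t'] x y.
    rewrite !inE => xK /andP[ys yK] xy.
    have [yt|yt] := eqVneq y t.
      rewrite yt in xy *; case/orP: xK => [/eqP->|/andP[xs xK]].
        by rewrite /reattach (negPf tX) (negPf t'X) edge_sym.
      by rewrite /reattach (negPf tX) XK // !AE xs xy xK !inE eqxx.
    have yA : y \in A by rewrite AE ys yt.
    have yX := subsetP AX _ yA.
    case/orP: xK => [/eqP->|/andP[xs xK]].
      by rewrite /reattach (negPf t'X) yX yA !inE eqxx orbT.
    have [xt|xt] := eqVneq x t.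
      by rewrite xt /reattach (negPf tX) yX yA !inE eqxx.
    rewrite /reattach yX (subsetP AX) ?AE ?xs ?xt //; exact: edge_K.
  split=> [x y xK /setU1P[->|yK] xy|]; last first.
  - have t'Ks : t' \notin K :\ s by rewrite !inE negb_and t'K orbT.
    by rewrite cardsU1 t'Ks (cardsD1 s K) sK.
  - exact: cl.
  - case/setU1P: xK xy => [->|xK xy]; first by rewrite eqxx.
    by rewrite reattach_sym cl // ?setU11 // eq_sym.
have [cK1 wK1] := slid_clique u v v' (erefl _) uv v'K pv'.
have vu : v != u by rewrite eq_sym.
have [cK2 wK2] := slid_clique v u u' (setUC _ _) vu u'K pu'.
(* Strictness occurs at [v], which lies in the old pair and in [[set v; v']] but not in
   [[set u; u']]. *)
apply: (@reattach_dominated _ G_conn X A _ _ _ [set u; v] _ _ _ _ #|K|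
  [set v; v'] [set u; u'] _ _ v _ _ _ _ _ _ cK1 wK1 cK2 wK2);
  rewrite ?pair_neq0 ?pair_clique ?pair_out //.
- move=> x y xX yX; apply/idP/andP=> [|[/AK[xK xu xv] /set2P ys]]; last first.
    by case: ys => ->; apply: edge_K.
  rewrite edgeE => /or3P[/and3P[xK yK _]|/andP[xK /eqP pxy]|/andP[yK /eqP pyx]].
  + rewrite -XK // xX; split=> //.
    by move: yX; rewrite XK // !inE yK andbT negbK.
  + by move: yX; rewrite -pxy Xp // xX.
  + by move: yX; rewrite -Xp // pyx xX.
- move=> y yX; rewrite !set_dist_set2.
  have u'v'0 : u' != v' by apply: contraNneq uv => e; rewrite -pu' e pv'.
  have below_u' x : x \in K -> x \notin below u' by apply: below_K_disjoint.
  have below_v' x : x \in K -> x \notin below v' by apply: below_K_disjoint.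
  have u'v' : u' \notin below v'.
    apply/negP=> /below_p /(_ u'v'0); rewrite pu'.
    by apply/negP; apply: below_v'.
  have v'u' : v' \notin below u'.
    rewrite eq_sym in u'v'0; apply/negP=> /below_p /(_ u'v'0); rewrite pv'.
    by apply/negP; apply: below_u'.
  have vu'_gt0 : 0 < dist v u'.
    by rewrite lt0n dist_eq0 //; apply: contraNneq u'K => <-.
  have uv'_gt0 : 0 < dist u v'.
    by rewrite lt0n dist_eq0 //; apply: contraNneq v'K => <-.
  have d1u := dist_edge G_conn uu'; have d1v := dist_edge G_conn vv'.
  have d1 := dist_edge G_conn uv_edge.
  have := dist_triangle G_conn u v y; have := dist_triangle G_conn v u y.
  have := dist_triangle G_conn u' u y; have := dist_triangle G_conn v' v y.
  rewrite (dist_sym G_conn v u) d1u d1v d1.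
  (* Below [v'], compared with [v], the pair [v v'] is at most one step closer and the pair [u u']
     at least one step further; below [u'] symmetrically. Elsewhere the new pairs are as far as [v]
     and [u], and the old distance is the smaller of the two. *)
  have [yv'|yv'] := boolP (y \in below v').
    have := below_dist_ge v'K yv' u'v'.
    have := below_dist_ge v'K yv' (below_v' u uK).
    rewrite pv' (dist_sym G_conn y u') (dist_sym G_conn v u) d1.
    rewrite (dist_sym G_conn y u).
    by move: vu'_gt0; clear; lia.
  have [yu'|yu'] := boolP (y \in below u').
    have := below_dist_ge u'K yu' v'u'.
    have := below_dist_ge u'K yu' (below_u' v vK).
    rewrite pu' (dist_sym G_conn y v') d1 (dist_sym G_conn y v).
    by move: uv'_gt0; clear; lia.
  have := below_dist_ge v'K (below_self v') yv'.
  have := below_dist_ge u'K (below_self u') yu'.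
  by rewrite pu' pv' !dist_self; clear; lia.
rewrite !set_dist_set2 dist_self (dist_edge G_conn uv_edge).
have : 0 < dist u' v by rewrite lt0n dist_eq0 //; apply: contraNneq u'K => ->.
by clear; lia.
Qed.

End ParentGraph.

(** * Recognizing the kite: no branching outside [K], and a single root [a] *)

Section KiteIso.
Variables (G : sgraph) (K : {set G}) (p : G -> G) (lv : G -> nat) (a : G).
Hypothesis aK : a \in K.
Hypothesis lv_eq0 : forall x, (lv x == 0) = (x \in K).
Hypothesis lvS : forall x, x \notin K -> lv x = (lv (p x)).+1.
Hypothesis edgeE : forall x y, edge x y = parent_edge K p x y.
Hypothesis p_inj : forall x y, x \notin K -> y \notin K -> p x = p y -> x = y.
Hypothesis p_root : forall x, x \notin K -> p x \in K -> p x = a.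
Implicit Types x y : G.

(** By induction on the level the parents agree, starting from the common root [a]; then [p_inj]
    applies. The trees thus form one path. *)
Lemma lv_inj x y : x \notin K -> y \notin K -> lv x = lv y -> x = y.
Proof.
have [k] := ubnP (lv x); elim: k x y => // k IHk x y lt_k xK yK e.
have e' : lv (p x) = lv (p y) by move: e; rewrite (lvS xK) (lvS yK) => -[].
apply: p_inj => //.
have [pxK|pxK] := boolP (p x \in K).
  by rewrite (p_root xK pxK) (p_root yK) // -lv_eq0 -e' lv_eq0.
apply: IHk => //; first by move: lt_k; rewrite (lvS xK).
by rewrite -lv_eq0 -e' lv_eq0.
Qed.

Lemma lv_onto x k : k <= lv x -> exists y, lv y = k.
Proof.
have [m] := ubnP (lv x); elim: m x => // m IHm x lt_m.
rewrite leq_eqVlt => /orP[/eqP->|lt_k]; first by exists x.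
have xK : x \notin K by rewrite -lv_eq0 -lt0n; apply: leq_ltn_trans lt_k.
by apply: (IHm (p x)); rewrite (lvS xK) in lt_m lt_k.
Qed.

(** The levels from 1 to [lv x] are all attained, necessarily outside [K]. *)
Lemma lv_bound x : #|K| + lv x <= #|G|.
Proof.
rewrite -(cardsC K) leq_add2l cardE -(size_map lv) -{1}(size_iota 1 (lv x)).
apply: uniq_leq_size => [|k]; first exact: iota_uniq.
rewrite mem_iota add1n ltnS => /andP[k_gt0 /lv_onto[y ly]].
apply/mapP; exists y => //.
by rewrite mem_enum inE -lv_eq0 ly -lt0n.
Qed.

(** The root [a] comes last, because in [Ki] the path is attached to the last vertex of the
    clique. *)
Let Kseq := rcons (enum (K :\ a)) a.

Let mem_Kseq x : (x \in Kseq) = (x \in K).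
Proof.
by rewrite mem_rcons inE mem_enum !inE; case: eqP => //= ->; rewrite aK.
Qed.

Let size_Kseq : size Kseq = #|K|.
Proof. by rewrite size_rcons -cardE (cardsD1 a K) aK. Qed.

Let index_a : index a Kseq = #|K|.-1.
Proof.
rewrite /Kseq -cats1 index_cat mem_enum !inE eqxx /= eqxx addn0 -cardE.
by rewrite (cardsD1 a K) aK.
Qed.

(** The offset [#|K|.-1] places level 1 at position [#|K|], right after [a]. *)
Let pos x : nat := if x \in K then index x Kseq else #|K|.-1 + lv x.

Let K_gt0 : 0 < #|K|. Proof. by apply/card_gt0P; exists a. Qed.

Let pos_lt x : pos x < #|G|.
Proof.
rewrite /pos; case: ifP => [xK|_].
  apply: leq_trans (max_card (mem K)); rewrite -size_Kseq index_mem.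
  by rewrite mem_Kseq.
by have := lv_bound x; move: K_gt0; clear; lia.
Qed.

Let pos_ltK x : (pos x < #|K|) = (x \in K).
Proof.
rewrite /pos; case: ifP => [xK|/negbT xK].
  by rewrite -size_Kseq index_mem mem_Kseq.
by move: (lvS xK) K_gt0; clear; lia.
Qed.

Let pos_inj : injective pos.
Proof.
move=> x y e; have := pos_ltK x; rewrite e pos_ltK => xy.
move: e; rewrite /pos -xy; case: (boolP (y \in K)) => yK.
  have xs : x \in Kseq by rewrite mem_Kseq -xy.
  have ys : y \in Kseq by rewrite mem_Kseq.
  exact: (index_inj a xs ys).
by move/addnI/lv_inj; apply; rewrite ?yK // -xy.
Qed.

Lemma kite_iso : sgraph_iso G (Ki #|G| #|K|).
Proof.
exists (fun x => Ordinal (pos_lt x)); split.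
  apply: inj_card_bij; last by rewrite card_ord.
  by move=> x y [] /pos_inj.
move=> x y; rewrite /= /kite_edge /= !pos_ltK edgeE /parent_edge.
(* Between the clique and the path, positions can be consecutive only at [#|K|.-1] and [#|K|], which
   means [u = a] and [v] at level 1. *)
have half (u v : G) : u \in K -> v \notin K ->
    ((pos u).+1 == pos v) || ((pos v).+1 == pos u) = (p v == u).
  move=> uK vK; have u_lt := pos_ltK u; have v_lt := pos_ltK v.
  rewrite uK in u_lt; rewrite (negPf vK) in v_lt.
  have lpv := lvS vK.
  apply/idP/eqP=> [h|pvu].
    have lpv0 : lv (p v) = 0.
      have : pos v = #|K|.-1 + lv v by rewrite /pos (negPf vK).
      by move: h u_lt v_lt K_gt0 lpv; clear; lia.
    have pvK : p v \in K by rewrite -lv_eq0 lpv0.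
    rewrite p_root //; apply/pos_inj; rewrite {1}/pos aK index_a.
    have : pos v = #|K|.-1 + lv v by rewrite /pos (negPf vK).
    by move: h u_lt v_lt K_gt0 lpv lpv0; clear; lia.
  have ua : u = a by rewrite -pvu p_root // pvu.
  have lu : lv u = 0 by apply/eqP; rewrite lv_eq0.
  rewrite /pos uK (negPf vK) ua index_a lpv pvu lu.
  by move: K_gt0; clear; lia.
have lv_p (u v : G) : u \notin K -> v \notin K ->
    (pos v).+1 == pos u = (p u == v).
  move=> uK vK; rewrite /pos (negPf uK) (negPf vK).
  rewrite -addnS eqn_add2l (lvS uK) eqSS.
  apply/eqP/eqP=> [e|->] //; apply: lv_inj => //.
  by rewrite -lv_eq0 -e lv_eq0.
have [xK|xK] := boolP (x \in K); have [yK|yK] := boolP (y \in K) => //=.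
- rewrite orbF; apply/idP/idP; apply: contraNN => /eqP.
    by move->.
  by case=> /pos_inj ->.
- by rewrite half.
- by rewrite orbC half // orbF.
- by rewrite orbC !lv_p.
Qed.

End KiteIso.

(** * Graphs that are not dominated are kites *)

Lemma undominated_kite (G : sgraph) (K : {set G}) (w : nat) :
  1 < w -> sgraph_connected G -> clique K -> #|K| = w -> ~ dominated w G ->
  sgraph_iso G (Ki #|G| w).
Proof.
move=> w_gt1 G_conn.
(* The clique [L] is left free because for [w = 2] the given clique may have children at both
   ends. *)
have finish (L : {set G}) (p : G -> G) (lv : G -> nat) :
    clique L -> #|L| = w -> ~ dominated w G ->
    (forall x, x \in L -> p x = x) -> (forall x, (lv x == 0) = (x \in L)) ->
    (forall x, x \notin L -> lv x = (lv (p x)).+1) ->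
    (forall x y, edge x y = parent_edge L p x y) ->
    (forall x y, x \notin L -> y \notin L -> p x \in L -> p y \in L ->
       p x = p y) ->
    sgraph_iso G (Ki #|G| w).
  move=> cL wL undom p_id lv0 lvS edgeE root.
  have L_gt1 : 1 < #|L| by rewrite wL.
  have p_inj x y : x \notin L -> y \notin L -> p x = p y -> x = y.
    move=> xL yL e; apply/eqP; apply: contra_notT undom => xy.
    by rewrite -wL; apply: (branch_dominated G_conn L_gt1 p_id lvS edgeE xL yL).
  have [a aL aroot] : exists2 a, a \in L &
      forall x, x \notin L -> p x \in L -> p x = a.
    case: (pickP [pred x | (x \notin L) && (p x \in L)]) =>
        [x /andP[xL pxL] | no].
      by exists (p x) => // y yL pyL; apply: root.
    (* If nothing hangs on [L], any of its vertices serves as root. *)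
    have [a aL] : exists a, a \in L by apply/card_gt0P; apply: ltnW.
    by exists a => // x xL pxL; have := no x; rewrite /= xL pxL.
  by rewrite -wL; apply: (kite_iso aL lv0 lvS edgeE p_inj aroot).
move=> cK wK undom.
have K0 : K != set0 by rewrite -card_gt0 wK ltnW.
have [p [lv [p_id lv0 lvS edgeE]]] : exists (p : G -> G) (lv : G -> nat),
    [/\ forall x, x \in K -> p x = x, forall x, (lv x == 0) = (x \in K),
        forall x, x \notin K -> lv x = (lv (p x)).+1 &
        forall x y, edge x y = parent_edge K p x y].
  by apply: undominated_parent => //; rewrite wK.
have [w_gt2|w_le2] := ltnP 2 w.
  apply: (finish K p lv) => // x y xK yK pxK pyK; apply/eqP.
  apply: contra_notT undom => ne; rewrite -wK.
  by apply: (slide_dominated G_conn p_id edgeE _ pxK pyK ne xK yK);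
    rewrite ?wK.
have w2 : w = 2 by apply/eqP; rewrite eqn_leq w_le2.
have [KT|] := eqVneq K setT.
  by apply: (finish K p lv) => // x y; rewrite KT inE.
rewrite -subTset => /subsetPn[z0 _ z0K].
(* For w = 2 the clique is replaced by the edge at a leaf x, where no branch
   can start. *)
case: (@arg_maxnP _ z0 [pred y | y \notin K] lv z0K) => x /= xK lv_max.
(* A vertex of maximal level has no child, so its parent is its only neighbour. *)
have x_leaf y : edge x y -> y = p x.
  rewrite edgeE => /or3P[/and3P[xK' _ _]|/andP[_ /eqP //]|/andP[yK /eqP pyx]].
    by rewrite xK' in xK.
  by have := lv_max y yK; rewrite (lvS _ yK) pyx ltnn.
have x_px : edge x (p x) by rewrite edgeE /parent_edge xK eqxx orbT.
have x_neq : x != p x by apply: contraTneq x_px => <-; rewrite edge_irrefl.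
have cL : clique [set x; p x].
  apply/cliqueP=> u v /set2P[]-> /set2P[]->; rewrite ?eqxx //.
  by rewrite edge_sym.
have wL : #|[set x; p x]| = w by rewrite cards2 x_neq w2.
have [q [lq [q_id lq0 lqS edgeE']]] : exists (q : G -> G) (lq : G -> nat),
    [/\ forall y, y \in [set x; p x] -> q y = y,
        forall y, (lq y == 0) = (y \in [set x; p x]),
        forall y, y \notin [set x; p x] -> lq y = (lq (q y)).+1 &
        forall y z, edge y z = parent_edge [set x; p x] q y z].
  apply: undominated_parent; rewrite ?wL //.
  by apply/set0Pn; exists x; rewrite set21.
(* A child of [x] would be a second neighbour of the leaf, so everything hangs on [p x]. *)
have q_px y : y \notin [set x; p x] -> q y \in [set x; p x] -> q y = p x.
  move=> yL /set2P[] // qyx; have := yL; rewrite (x_leaf y) ?set22 //.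
  by rewrite edgeE' /parent_edge set21 yL qyx eqxx orbT.
apply: (finish [set x; p x] q lq) => // y z yL zL qyL qzL.
by rewrite (q_px y) // (q_px z).
Qed.

(* Rayleigh quotients and the Perron vector of a symmetric matrix *)
From mathcomp Require Import boolp classical_sets reals topology normedtype.
From mathcomp Require Import derive ring lra.

Import GRing.Theory Num.Theory numFieldNormedType.Exports.
Local Open Scope ring_scope.

(** At [t = - (b / d)] with [d = |c| + 1 > c], the expression equals [(c - d) * (b / d) ^+ 2], which
    is negative unless [b = 0]. *)
Lemma linear_coef_eq0 (R : realFieldType) (b c : R) :
  (forall t, 0 <= t * b + t ^+ 2 * c) -> b = 0.
Proof.
move=> pos; pose d := `|c| + 1; have d_gt0 : 0 < d by rewrite ltr_wpDl.
have c_lt : c - d < 0 by rewrite subr_lt0 (le_lt_trans (ler_norm c)) // ltrDl.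
have := pos (- (b / d)).
have -> : - (b / d) * b + (- (b / d)) ^+ 2 * c = (c - d) * (b / d) ^+ 2.
  by field; rewrite gt_eqF.
rewrite nmulr_rge0 // => b2.
have : (b / d) ^+ 2 == 0 by rewrite eq_le b2 sqr_ge0.
by rewrite sqrf_eq0 mulf_eq0 invr_eq0 (gt_eqF d_gt0) orbF => /eqP.
Qed.

Section Perron.
Variables (R : realType) (n : nat) (A : 'M[R]_n).
Implicit Types (x y z : 'rV[R]_n).

Definition sqnorm y : R := \sum_i y 0 i ^+ 2.
Definition bilin y z : R := \sum_i \sum_j A i j * y 0 i * z 0 j.

Lemma coord_sq_le_sqnorm y i : y 0 i ^+ 2 <= sqnorm y.
Proof.
by rewrite /sqnorm (bigD1 i) //= lerDl sumr_ge0 // => j _; apply: sqr_ge0.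
Qed.

Lemma sqnorm_eq0 y : (sqnorm y == 0) = (y == 0).
Proof.
apply/eqP/eqP=> [N0|->]; last first.
  by rewrite /sqnorm big1 // => i _; rewrite mxE expr0n.
apply/rowP=> i; apply/eqP; rewrite !mxE -[_ == 0]sqrf_eq0.
by rewrite eq_le sqr_ge0 -N0 coord_sq_le_sqnorm.
Qed.

Lemma sqnorm_ge0 y : 0 <= sqnorm y.
Proof. by apply: sumr_ge0 => i _; apply: sqr_ge0. Qed.

Lemma sqnormZ a y : sqnorm (a *: y) = a ^+ 2 * sqnorm y.
Proof.
by rewrite /sqnorm mulr_sumr; apply: eq_bigr => i _; rewrite mxE exprMn.
Qed.

Lemma bilinZ a y : bilin (a *: y) (a *: y) = a ^+ 2 * bilin y y.
Proof.
rewrite /bilin mulr_sumr; apply: eq_bigr => i _; rewrite mulr_sumr.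
by apply: eq_bigr => j _; rewrite !mxE; ring.
Qed.

Lemma bilin_mul y z : bilin y z = \sum_j (y *m A) 0 j * z 0 j.
Proof.
rewrite /bilin exchange_big; apply: eq_bigr => j _.
by rewrite mxE mulr_suml; apply: eq_bigr => i _; ring.
Qed.

Lemma coord_mul_continuous i j : continuous (fun y => y 0 i * y 0 j).
Proof. by move=> y; apply: continuousM; apply: coord_continuous. Qed.

Lemma sqnorm_continuous : continuous sqnorm.
Proof.
apply: (continuous_big (@add_continuous R)) => i _.
exact: coord_mul_continuous.
Qed.

Lemma rayleigh_continuous : continuous (fun y => bilin y y).
Proof.
apply: (continuous_big (@add_continuous R)) => i _.
apply: (continuous_big (@add_continuous R)) => j _ y.
rewrite (_ : (fun x => _) =
  (fun=> A i j) \* (fun x : 'rV[R]_n => x 0 i * x 0 j)); last first.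
  by apply/funext=> x /=; rewrite mulrA.
apply: continuousM; first exact: cst_continuous.
exact: coord_mul_continuous.
Qed.

Lemma sphere_compact : compact [set y | sqnorm y = 1]%classic.
Proof.
apply: bounded_closed_compact.
  exists 1; split=> // M M_gt1 y /= Ny; apply: le_trans (ltW M_gt1).
  (* The norm on row vectors is the largest absolute value of a coordinate, at most 1 on the
     sphere. *)
  rewrite /Num.norm /= mx_normrE; apply: bigmax_le => // -[i j] _ /=.
  rewrite ord1 -(expr_le1 (n:=2)) // real_normK ?num_real // -Ny.
  exact: coord_sq_le_sqnorm.
apply: (@preimage_closed _ _ sqnorm [set 1]%classic); last exact: closed_eq.
by move=> y _; apply: sqnorm_continuous.
Qed.

(** The extreme value theorem on the unit sphere gives [y]; scaling by [s] extends the bound to all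
    nonzero [z]. *)
Lemma rayleigh_max : (0 < n)%N ->
  exists2 y, sqnorm y = 1 & forall z, bilin z z <= bilin y y * sqnorm z.
Proof.
move=> n_gt0.
have ne : ([set y | sqnorm y = 1] !=set0)%classic.
  exists (delta_mx 0 (Ordinal n_gt0)).
  rewrite /= /sqnorm (bigD1 (Ordinal n_gt0)) //=.
  rewrite mxE !eqxx expr1n big1 ?addr0 // => i /negPf ne.
  by rewrite mxE ne andbF expr0n.
have [y Ny max_y] := EVT_max_rV ne sphere_compact
  (continuous_subspaceT rayleigh_continuous).
move: Ny; rewrite inE => /= Ny; exists y => // z.
have [->|z0] := eqVneq z 0.
  rewrite (eqP (_ : sqnorm 0 == 0)) ?sqnorm_eq0 // mulr0.
  by rewrite -(scale0r y) bilinZ expr0n mul0r.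
have Nz : 0 < sqnorm z by rewrite lt_def sqnorm_eq0 z0 sqnorm_ge0.
pose s := (Num.sqrt (sqnorm z))^-1.
have s2 : s ^+ 2 * sqnorm z = 1.
  by rewrite exprVn sqr_sqrtr ?ltW // mulVf // gt_eqF.
have := max_y (s *: z); rewrite inE /= sqnormZ bilinZ => /(_ s2) le_s.
have : bilin z z = sqnorm z * (s ^+ 2 * bilin z z).
  by rewrite mulrA (mulrC _ (s ^+ 2)) s2 mul1r.
by move->; rewrite [leRHS]mulrC ler_wpM2l // ltW.
Qed.

Lemma sqnormD y z : sqnorm (y + z) =
  sqnorm y + 2 * (\sum_i y 0 i * z 0 i) + sqnorm z.
Proof.
rewrite /sqnorm mulr_sumr -!big_split; apply: eq_bigr => i _ /=.
by rewrite mxE; ring.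
Qed.

Hypothesis A_sym : forall i j, A i j = A j i.

Lemma bilinC y z : bilin y z = bilin z y.
Proof.
rewrite /bilin exchange_big; apply: eq_bigr => i _; apply: eq_bigr => j _.
by rewrite A_sym; ring.
Qed.

Lemma bilinD y z : bilin (y + z) (y + z) =
  bilin y y + 2 * bilin y z + bilin z z.
Proof.
have -> : 2 * bilin y z = bilin y z + bilin z y by rewrite (bilinC z); ring.
rewrite /bilin -!big_split; apply: eq_bigr => i _ /=.
by rewrite -!big_split; apply: eq_bigr => j _ /=; rewrite !mxE; ring.
Qed.

Lemma bilinZr y a z : bilin y (a *: z) = a * bilin y z.
Proof.
rewrite !bilin_mul mulr_sumr; apply: eq_bigr => i _.
by rewrite [(a *: z) 0 i]mxE; ring.
Qed.

(** The function [l * sqnorm - bilin] is nonnegative and vanishes at [y], so its linear term along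
    each unit vector is zero; this is the eigenvector equation by coordinates. *)
Lemma rayleigh_max_eigenvector l y : bilin y y = l * sqnorm y ->
  (forall z, bilin z z <= l * sqnorm z) -> y *m A = l *: y.
Proof.
move=> Qy le_l; apply/rowP=> i.
suff /eqP : 2 * (l * y 0 i - (y *m A) 0 i) = 0.
  by rewrite mulf_eq0 pnatr_eq0 /= subr_eq0 [(l *: y) 0 i]mxE => /eqP ->.
have sum_delta (f : 'I_n -> R) : \sum_j f j * delta_mx (0 : 'I_1) i 0 j = f i.
  rewrite (bigD1 i) //= mxE !eqxx mulr1 big1 ?addr0 // => j /negPf ji.
  by rewrite mxE ji andbF mulr0.
pose e := delta_mx (0 : 'I_1) i : 'rV[R]_n.
apply: (@linear_coef_eq0 _ _ (l * sqnorm e - bilin e e)) => t.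
have := le_l (y + t *: e).
rewrite sqnormD bilinD bilinZ bilinZr sqnormZ Qy.
have -> : \sum_j y 0 j * (t *: e) 0 j = t * y 0 i.
  rewrite -[in RHS](sum_delta (fun j => y 0 j)) mulr_sumr.
  by apply: eq_bigr => j _; rewrite mxE; ring.
have -> : bilin y e = (y *m A) 0 i by rewrite bilin_mul sum_delta.
by rewrite -subr_ge0 => h; apply: etrans h; congr (0 <= _); ring.
Qed.

(** Evaluating the form at an eigenvector bounds every eigenvalue by [l], so the supremum is
    attained at [l]. *)
Lemma largest_eigenvalueE l y : y != 0 -> y *m A = l *: y ->
  (forall z, bilin z z <= l * sqnorm z) -> largest_eigenvalue A = l.
Proof.
move=> y0 yA le_l.
have l_ev : eigenvalue A l by apply/eigenvalueP; exists y.
have ub : ubound [set a | eigenvalue A a]%classic l.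
  move=> a /= /eigenvalueP[v vA v0].
  have Nv : 0 < sqnorm v by rewrite lt_def sqnorm_eq0 v0 sqnorm_ge0.
  rewrite -(ler_pM2r Nv) (le_trans _ (le_l v)) // bilin_mul vA mulr_sumr.
  by apply: ler_sum => i _; rewrite mxE expr2 mulrA.
apply/eqP; rewrite eq_le; apply/andP; split.
  by apply: ge_sup ub; exists l.
by apply: ub_le_sup; [exists l | ].
Qed.

Hypothesis A_pos : forall i j, i != j -> 0 < A i j.

(** Absolute values of the coordinates of a maximizer do not decrease the form, as off-diagonal
    entries are positive. A zero coordinate of the resulting eigenvector would force all the others
    to vanish. *)
Lemma perron : (0 < n)%N ->
  exists2 y, sqnorm y = 1 /\ (forall i, 0 < y 0 i) &
    bilin y y = largest_eigenvalue A /\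
    forall z, bilin z z <= largest_eigenvalue A * sqnorm z.
Proof.
move=> n_gt0; have [x Nx max_x] := rayleigh_max n_gt0.
set l := bilin x x in max_x.
pose y : 'rV[R]_n := \row_i `|x 0 i|.
have Ny : sqnorm y = 1.
  by rewrite -Nx; apply: eq_bigr => i _; rewrite mxE real_normK ?num_real.
have Qy : bilin y y = l.
  apply/eqP; rewrite eq_le -{1}[l]mulr1 -{1}Ny max_x /=.
  apply: ler_sum => i _; apply: ler_sum => j _; rewrite !mxE -!mulrA.
  have [->|/A_pos Aij] := eqVneq i j.
    by rewrite -!expr2 real_normK ?num_real.
  by rewrite -normrM ler_wpM2l ?ler_norm // ltW.
have yA : y *m A = l *: y.
  by apply: rayleigh_max_eigenvector => //; rewrite Ny mulr1.
have y_ge0 i : 0 <= y 0 i by rewrite mxE.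
have y_gt0 i : 0 < y 0 i.
  rewrite lt_def y_ge0 andbT; apply/eqP=> yi0.
  have sum0 : \sum_j y 0 j * A j i == 0.
    by have /rowP/(_ i) := yA; rewrite [RHS]mxE yi0 mulr0 [LHS]mxE => ->.
  have term_ge0 j : true -> 0 <= y 0 j * A j i.
    have [->|/A_pos Aji] := eqVneq j i; first by rewrite yi0 mul0r.
    by move=> _; rewrite mulr_ge0 // ltW.
  move: sum0; rewrite psumr_eq0 // => /allP all0.
  suff y0 : y = 0.
    move/eqP: Ny; rewrite y0 (eqP (_ : sqnorm 0 == 0)) ?sqnorm_eq0 //.
    by rewrite eq_sym oner_eq0.
  apply/rowP=> j; rewrite [RHS]mxE.
  have [->//|/A_pos Aji] := eqVneq j i.
  have := all0 j (mem_index_enum j); rewrite /= mulf_eq0 (gt_eqF Aji) orbF.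
  by move/eqP.
have y0 : y != 0 by rewrite -sqnorm_eq0 Ny oner_eq0.
have lE := largest_eigenvalueE y0 yA max_x.
by exists y => //; rewrite lE.
Qed.

End Perron.

Lemma lt_average (R : realFieldType) (a b c b' c' : R) :
  2 * a < b + c -> b <= b' -> c <= c' -> a < b' \/ a < c'.
Proof.
move=> lt leb lec; have [|ge] := ltP a b'; [by left | right].
by lra.
Qed.

(** * The quadratic form of the distance matrix and its growth under domination *)

Section DistAlpha.
Variables (R : realType) (alpha : R).
Hypotheses (alpha_ge0 : 0 <= alpha) (alpha_lt1 : alpha < 1).
Implicit Type G : sgraph.

Lemma dist_alpha_mxE G (i j : 'I_#|G|) : dist_alpha_mx alpha G i j =
  alpha * ((transmission (enum_val i : G))%:R *+ (i == j)) +
  (1 - alpha) * (dist (enum_val i : G) (enum_val j : G))%:R.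
Proof. by rewrite !mxE. Qed.

Lemma dist_alpha_mx_sym G : sgraph_connected G ->
  forall i j, dist_alpha_mx alpha G i j = dist_alpha_mx alpha G j i.
Proof.
move=> G_conn i j; rewrite !dist_alpha_mxE (dist_sym G_conn) eq_sym.
by case: eqP => // ->.
Qed.

Lemma dist_alpha_mx_gt0 G : sgraph_connected G ->
  forall i j, i != j -> 0 < dist_alpha_mx alpha G i j.
Proof.
move=> G_conn i j ij; rewrite dist_alpha_mxE (negPf ij) mulr0n mulr0 add0r.
rewrite mulr_gt0 ?subr_gt0 // ltr0n lt0n dist_eq0 //.
by rewrite (inj_eq enum_val_inj).
Qed.

Lemma transmission_ord G (u : G) :
  transmission u = (\sum_(j < #|G|) dist u (enum_val j : G))%N.
Proof. by rewrite /transmission (reindex _ (onW_bij _ (@enum_val_bij G))). Qed.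

(** Transmissions are expanded into distances, which makes the form of [dist_alpha_mx] linear in the
    distances, with positive weights for positive [z]. *)
Definition alpha_form G (z : G -> R) : R :=
  \sum_u \sum_v (dist u v)%:R * (alpha * z u ^+ 2 + (1 - alpha) * (z u * z v)).

Lemma bilin_alpha_form G (z : G -> R) :
  let y := \row_i z (enum_val i) in
  bilin (dist_alpha_mx alpha G) y y = alpha_form z.
Proof.
move=> y; rewrite /bilin /alpha_form (reindex _ (onW_bij _ (@enum_val_bij G))).
apply: eq_bigr => i _; rewrite [RHS](reindex _ (onW_bij _ (@enum_val_bij G))).
under [LHS]eq_bigr => j _ do rewrite dist_alpha_mxE 2!mulrDl.
under [RHS]eq_bigr => j _ do rewrite mulrDr.
rewrite !big_split; congr (_ + _); last first.
  by apply: eq_bigr => j _; rewrite !mxE; ring.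
rewrite (bigD1 i) //= eqxx mulr1n big1 ?addr0 => [|j /negPf ji]; last first.
  by rewrite eq_sym ji mulr0n mulr0 !mul0r.
rewrite transmission_ord natr_sum mulr_sumr !mulr_suml.
by apply: eq_bigr => j _; rewrite !mxE; ring.
Qed.

Lemma sqnorm_row G (z : G -> R) :
  sqnorm (\row_(i < #|G|) z (enum_val i)) = \sum_u z u ^+ 2.
Proof.
rewrite [RHS](reindex _ (onW_bij _ (@enum_val_bij G))).
by apply: eq_bigr => i _; rewrite mxE.
Qed.

Lemma alpha_form_le G (z : G -> R) : (0 < #|G|)%N -> sgraph_connected G ->
  alpha_form z <= dist_alpha_radius alpha G * \sum_u z u ^+ 2.
Proof.
move=> G_gt0 G_conn; rewrite -bilin_alpha_form -sqnorm_row.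
have [_ _ [_]] :=
  perron (dist_alpha_mx_sym G_conn) (dist_alpha_mx_gt0 G_conn) G_gt0.
exact.
Qed.

Lemma alpha_form_attained G : (0 < #|G|)%N -> sgraph_connected G ->
  exists2 z : G -> R, (forall u, 0 < z u) /\ \sum_u z u ^+ 2 = 1 &
    alpha_form z = dist_alpha_radius alpha G.
Proof.
move=> G_gt0 G_conn.
have [y [Ny y_gt0] [Qy _]] :=
  perron (dist_alpha_mx_sym G_conn) (dist_alpha_mx_gt0 G_conn) G_gt0.
have yE : y = \row_(i < #|G|) (fun u => y 0 (enum_rank u)) (enum_val i).
  by apply/rowP=> i; rewrite mxE enum_valK.
exists (fun u => y 0 (enum_rank u)); first by rewrite -sqnorm_row -yE.
by rewrite -bilin_alpha_form -yE.
Qed.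

Lemma dominated_radius_lt (w : nat) G : (0 < #|G|)%N -> sgraph_connected G ->
  dominated w G -> exists2 e : rel G, connected_with_clique e w &
    dist_alpha_radius alpha G < dist_alpha_radius alpha (graph_on e).
Proof.
move=> G_gt0 G_conn [e1 [e2 [good1 good2 avg [u0 [v0 avg0]]]]].
have /connected_with_cliqueP[conn1 _] := good1.
have /connected_with_cliqueP[conn2 _] := good2.
have [z [z_gt0 Nz] Qz] := alpha_form_attained G_gt0 G_conn.
(* The graphs share their vertices, so the Perron vector of [G] is a trial vector for both
   others. *)
have le1 := @alpha_form_le (graph_on e1) z G_gt0 conn1.
have le2 := @alpha_form_le (graph_on e2) z G_gt0 conn2.
rewrite [X in _ * X]Nz mulr1 in le1; rewrite [X in _ * X]Nz mulr1 in le2.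
suff lt12 : 2 * alpha_form z <
    @alpha_form (graph_on e1) z + @alpha_form (graph_on e2) z.
  rewrite Qz in lt12; case: (lt_average lt12 le1 le2) => lt.
    exact: (ex_intro2 _ _ e1 good1 lt).
  exact: (ex_intro2 _ _ e2 good2 lt).
pose weight u v : R := alpha * z u ^+ 2 + (1 - alpha) * (z u * z v).
have weight_gt0 u v : 0 < weight u v.
  apply: ltr_wpDl; first by rewrite mulr_ge0 ?sqr_ge0.
  by rewrite !mulr_gt0 // subr_gt0.
(* Twice the average gain of the form is the weighted sum of the gaps, which are nonnegative and
   positive at [u0], [v0]. *)
pose gap (u v : G) : R :=
  (@dist (graph_on e1) u v + @dist (graph_on e2) u v)%:R -
  (2 * @dist G u v)%:R.
have gap_ge0 u v : 0 <= gap u v. by rewrite subr_ge0 ler_nat avg.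
rewrite -subr_gt0.
have -> : @alpha_form (graph_on e1) z + @alpha_form (graph_on e2) z -
    2 * alpha_form z = \sum_u \sum_v gap u v * weight u v.
  rewrite /alpha_form mulr_sumr -big_split -sumrB; apply: eq_bigr => u _ /=.
  rewrite mulr_sumr -big_split -sumrB; apply: eq_bigr => v _ /=.
  by rewrite /gap /weight natrD natrM; ring.
rewrite (bigD1 u0) //= (bigD1 v0) //= -addrA ltr_wpDr //.
  apply: addr_ge0; first by apply: sumr_ge0 => v _; rewrite mulr_ge0 // ltW.
  by apply: sumr_ge0 => u _; apply: sumr_ge0 => v _; rewrite mulr_ge0 // ltW.
by rewrite mulr_gt0 // subr_gt0 ltr_nat.
Qed.

End DistAlpha.

(** * Invariance of the radius under isomorphism *)

Lemma iso_dist_le (G H : sgraph) (f : G -> H) (u v : G) :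
  sgraph_connected G -> (forall x y, edge x y -> edge (f x) (f y)) ->
  sgraph_connected H -> (dist (f u) (f v) <= dist u v)%N.
Proof.
move=> G_conn f_edge H_conn; rewrite -[leqRHS]add0n -(dist_self (f u)).
apply: (lipschitz_le_dist G_conn (f := fun x => dist (f u) (f x))) => x y xy.
by apply: dist_edge_le => //; apply: f_edge.
Qed.

Section Iso.
Variables (R : realType) (alpha : R) (G H : sgraph) (f : G -> H).
Hypotheses (G_conn : sgraph_connected G) (f_bij : bijective f).
Hypothesis f_edge : forall u v, edge (f u) (f v) = edge u v.

Lemma iso_connected : sgraph_connected H.
Proof.
case: f_bij => g fK gK u v; rewrite -(gK u) -(gK v).
have /connectP[q] := G_conn (g u) (g v); elim: q (g u) => [|y q IHq] x /=.
  by move=> _ ->.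
case/andP=> xy Gq lq; apply: connect_trans (IHq y Gq lq).
by apply: connect1; rewrite f_edge.
Qed.

Lemma iso_dist u v : dist (f u) (f v) = dist u v.
Proof.
have H_conn := iso_connected; case: (f_bij) => g fK gK.
apply/eqP; rewrite eqn_leq iso_dist_le //; last by move=> x y; rewrite f_edge.
rewrite -{1}(fK u) -{1}(fK v) iso_dist_le // => x y.
by rewrite -{1}(gK x) -{1}(gK y) f_edge.
Qed.

Lemma iso_transmission u : transmission (f u) = transmission u.
Proof.
rewrite /transmission (reindex f); last exact: onW_bij.
by apply: eq_bigr => v _; rewrite iso_dist.
Qed.

End Iso.

(** Indexing eigenvectors by vertices instead of ordinals lets an isomorphism transport them by
    composition. *)
Lemma eigenvalue_dist_alpha (R : realType) (alpha a : R) (G : sgraph) :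
  sgraph_connected G ->
  eigenvalue (dist_alpha_mx alpha G) a <->
  exists2 z : G -> R, exists u, z u != 0 &
    forall u, alpha * (transmission u)%:R * z u +
      (1 - alpha) * \sum_v (dist v u)%:R * z v = a * z u.
Proof.
move=> G_conn.
have mulE (v : 'rV[R]_#|G|) j : (v *m dist_alpha_mx alpha G) 0 j =
    alpha * (transmission (enum_val j : G))%:R * v 0 j +
    (1 - alpha) * \sum_(x : G) (dist x (enum_val j))%:R * v 0 (enum_rank x).
  rewrite mxE; under eq_bigr => i _ do rewrite dist_alpha_mxE mulrDr.
  rewrite big_split /=; congr (_ + _).
    rewrite (bigD1 j) //= eqxx mulr1n big1 ?addr0 => [|i /negPf ij].
      by ring.
    by rewrite ij mulr0n !mulr0.
  rewrite mulr_sumr [RHS](reindex _ (onW_bij _ (@enum_val_bij G))).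
  by apply: eq_bigr => i _; rewrite enum_valK; ring.
split=> [/eigenvalueP[v vA v0]|[z [u0 zu0] z_ev]].
  exists (fun u => v 0 (enum_rank u)).
    by case/rV0Pn: v0 => i vi; exists (enum_val i); rewrite enum_valK.
  move=> u; have /rowP/(_ (enum_rank u)) := vA.
  by rewrite mulE enum_rankK mxE.
apply/eigenvalueP; exists (\row_i z (enum_val i)).
  apply/rowP=> j; rewrite mulE [RHS]mxE [in RHS]mxE -z_ev mxE.
  by congr (_ + _ * _); apply: eq_bigr => x _; rewrite mxE enum_rankK.
by apply/rV0Pn; exists (enum_rank u0); rewrite mxE enum_rankK.
Qed.

Lemma dist_alpha_radius_iso (R : realType) (alpha : R) (G H : sgraph) :
  sgraph_connected G -> sgraph_iso G H ->
  dist_alpha_radius alpha G = dist_alpha_radius alpha H.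
Proof.
move=> G_conn [f [f_bij f_edge]].
have H_conn := iso_connected G_conn f_bij f_edge.
have distE := iso_dist G_conn f_bij f_edge.
have trE := iso_transmission G_conn f_bij f_edge.
rewrite /dist_alpha_radius /largest_eigenvalue; congr sup.
apply/seteqP; split=> a /=; rewrite !eigenvalue_dist_alpha //.
  case: (f_bij) => g fK gK [z [u zu] z_ev]; exists (z \o g).
    by exists (f u); rewrite /= fK.
  move=> v; rewrite -(gK v) trE /= fK -z_ev (reindex f) /=; last exact: onW_bij.
  by congr (_ + _ * _); apply: eq_bigr => x _; rewrite distE fK.
case=> z [u zu] z_ev; exists (z \o f).
  by case: (f_bij) => g fK gK; exists (g u); rewrite /= gK.
move=> v; rewrite /= -z_ev trE [in RHS](reindex f) /=; last exact: onW_bij.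
by congr (_ + _ * _); apply: eq_bigr => x _; rewrite distE.
Qed.

(** * The extremal argument *)

Lemma graph_on_edge_iso (G : sgraph) : sgraph_iso G (graph_on (@edge G)).
Proof.
exists id; split; first by exists id.
by move=> u v; rewrite (graph_onE (@edge_sym G) (@edge_irrefl G)).
Qed.

Lemma clique_number_attained (G : sgraph) :
  exists2 K : {set G}, clique K & #|K| = clique_number G.
Proof.
have : (0 < #|[pred A : {set G} | clique A]|)%N.
  apply/card_gt0P; exists finset.set0.
  by apply/cliqueP => x y; rewrite inE.
by case/(eq_bigmax_cond (fun A : {set G} => #|A|)) => K cK eK; exists K.
Qed.

Lemma connected_with_clique_edge (G : sgraph) (w : nat) (K : {set G}) :
  sgraph_connected G -> clique K -> #|K| = w ->
  connected_with_clique (@edge G) w.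
Proof.
move=> G_conn cK wK.
have [f [f_bij f_edge]] := graph_on_edge_iso G.
apply/connected_with_cliqueP; split.
  exact: iso_connected G_conn f_bij f_edge.
exists K => //; apply/cliqueP=> x y xK yK xy.
rewrite (graph_onE (@edge_sym G) (@edge_irrefl G)).
by move/cliqueP: cK; apply.
Qed.

(** The class given by [connected_with_clique] is finite and contains [e0], so a member of largest
    radius exists. It is not dominated, hence a kite. *)
Lemma maximal_radius_kite (R : realType) (alpha : R) (G : sgraph) (w : nat) :
  0 <= alpha -> alpha < 1 -> (0 < #|G|)%N -> (1 < w)%N ->
  (exists e0 : rel G, connected_with_clique e0 w) ->
  forall e : rel G, connected_with_clique e w ->
    dist_alpha_radius alpha (graph_on e) <= dist_alpha_radius alpha (Ki #|G| w).
Proof.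
move=> alpha_ge0 alpha_lt1 G_gt0 w_gt1 [e0 good0].
(* Relations are coded by finite functions, so that the maximum is over a finite type. *)
pose E (h : {ffun G * G -> bool}) : rel G := fun x y => h (x, y).
have E_onto (e : rel G) : exists h, E h = e.
  exists [ffun xy => e xy.1 xy.2].
  by apply/funext=> x; apply/funext=> y; rewrite /E ffunE.
have [h0 Eh0] := E_onto e0; rewrite -Eh0 in good0.
case: (@arg_maxP _ _ _ h0 (fun h => connected_with_clique (E h) w)
  (fun h => dist_alpha_radius alpha (graph_on (E h))) good0) => h good_h max_h.
have max_e (e : rel G) : connected_with_clique e w ->
    dist_alpha_radius alpha (graph_on e) <=
      dist_alpha_radius alpha (graph_on (E h)).
  by have [h' <-] := E_onto e; apply: max_h.
have /connected_with_cliqueP[conn_h [K cK wK]] := good_h.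
have undom : ~ dominated w (graph_on (E h)).
  case/(@dominated_radius_lt _ _ alpha_ge0 alpha_lt1 w (graph_on (E h)) G_gt0
    conn_h).
  move=> e good_e.
  by move/lt_geF; rewrite (max_e e good_e).
have iso_h := undominated_kite w_gt1 conn_h cK wK undom.
by rewrite -(dist_alpha_radius_iso alpha conn_h iso_h).
Qed.

Theorem theorem6p3 (R : realType) (alpha : R) (G : sgraph) (n omega : nat)
    (alpha_ge0 : 0 <= alpha) (alpha_lt1 : alpha < 1)
    (G_connected : sgraph_connected G)
    (G_order : #|G| = n) (n_ge2 : (2 <= n)%N)
    (G_clique : clique_number G = omega) (omega_ge2 : (2 <= omega)%N) :
  dist_alpha_radius alpha G <= dist_alpha_radius alpha (Ki n omega) /\
  (dist_alpha_radius alpha G = dist_alpha_radius alpha (Ki n omega) <->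
   sgraph_iso G (Ki n omega)).
Proof.
have G_gt0 : (0 < #|G|)%N by rewrite G_order ltnW.
have [K cK wK] := clique_number_attained G; rewrite G_clique in wK.
have good_G := connected_with_clique_edge G_connected cK wK.
have le_kite (e : rel G) : connected_with_clique e omega ->
    dist_alpha_radius alpha (graph_on e) <=
      dist_alpha_radius alpha (Ki n omega).
  rewrite -G_order; apply: maximal_radius_kite => //.
  by exists (@edge G).
split; last split.
- rewrite (dist_alpha_radius_iso alpha G_connected (graph_on_edge_iso G)).
  exact: le_kite.
(* If [G] were dominated, some graph of the class would have a larger radius than [G], hence than
   the kite. *)
- move=> eq_kite; rewrite -G_order.
  apply: (undominated_kite omega_ge2 G_connected cK wK).
  case/(dominated_radius_lt alpha_ge0 alpha_lt1 G_gt0 G_connected) => e good_e.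
  by rewrite ltNge eq_kite le_kite.
exact: dist_alpha_radius_iso.
Qed.
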